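(* Let $\mathcal{C}$ be a (small) $\Bbbk$-category. Then the category of $\mathcal{C}$-modules and the category of unital left $a(\mathcal{C})$-modules are equivalent.
   Context: $\Bbbk$ is a field. A $\Bbbk$-category is a category whose morphism sets ${}_y\mathcal{C}_x=\operatorname{Hom}_{\mathcal{C}}(x,y)$ are $\Bbbk$-vector spaces and whose composition is $\Bbbk$-bilinear; $\mathcal{C}_0$ denotes its objects. A $\mathcal{C}$-module is a $\Bbbk$-linear functor from $\mathcal{C}$ to the category of $\Bbbk$-vector spaces; morphisms are natural transformations. $a(\mathcal{C})$ is the (not necessarily unital) algebra with underlying space $\bigoplus_{x,y\in\mathcal{C}_0}{}_y\mathcal{C}_x$, whose elements are written as matrices $({}_yf_x)_{x,y\in\mathcal{C}_0}$ with finitely many nonzero entries, and whose product is matrix multiplication using the composition of $\mathcal{C}$. A left module $M$ over an algebra $R$ is unital if $RM=M$. *)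

(* Defs.v *)
From HB Require Import structures.
From mathcomp Require Import all_boot all_order all_algebra.
From mathcomp Require Import boolp classical_sets functions cardinality fsbigop.

Set Implicit Arguments.
Unset Strict Implicit.
Unset Printing Implicit Defensive.

Import GRing.Theory.
Local Open Scope classical_set_scope.
Local Open Scope ring_scope.
#[local] Obligation Tactic := try by [].

(* [mcomp g f] is "g after f". *)
Record category := Category {
  obj :> Type;
  mor : obj -> obj -> Type;
  idm : forall a, mor a a;
  mcomp : forall a b c, mor b c -> mor a b -> mor a c;
  compA : forall a b c d (h : mor c d) (g : mor b c) (f : mor a b),
    mcomp h (mcomp g f) = mcomp (mcomp h g) f;
  comp1m : forall a b (f : mor a b), mcomp (idm b) f = f;
  compm1 : forall a b (f : mor a b), mcomp f (idm a) = f }.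
Arguments idm {_} _.

Record functor (A B : category) := Functor {
  fobj :> A -> B;
  fmor : forall a b, mor a b -> mor (fobj a) (fobj b);
  fmor1 : forall a, fmor (idm a) = idm (fobj a);
  fmorM : forall a b c (g : mor b c) (f : mor a b),
    fmor (mcomp g f) = mcomp (fmor g) (fmor f) }.
Arguments fmor {A B} _ {a b} _.

Program Definition functor_id (A : category) : functor A A :=
  @Functor A A (fun a => a) (fun _ _ f => f) _ _.

Program Definition functor_comp (A B C : category)
    (G : functor B C) (F : functor A B) : functor A C :=
  @Functor A C (fun a => G (F a)) (fun _ _ f => fmor G (fmor F f)) _ _.
Next Obligation. by move=> A B C G F a /=; rewrite !fmor1. Qed.
Next Obligation. by move=> A B C G F a b c g f /=; rewrite !fmorM. Qed.

Definition is_iso (A : category) (a b : A) (f : mor a b) : Prop :=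
  exists g : mor b a, mcomp g f = idm a /\ mcomp f g = idm b.

Definition nat_isomorphic (A B : category) (F G : functor A B) : Prop :=
  exists t : forall a, mor (F a) (G a),
    (forall a b (f : mor a b), mcomp (t b) (fmor F f) = mcomp (fmor G f) (t a))
    /\ (forall a, is_iso (t a)).

Definition equivalent_categories (A B : category) : Prop :=
  exists (F : functor A B) (G : functor B A),
    nat_isomorphic (functor_comp G F) (functor_id A)
    /\ nat_isomorphic (functor_comp F G) (functor_id B).

(* Not built on [category]: the objects of a small k-category live in a
   universe no larger than that of the vector spaces over [k], whereas the
   categories of modules below are large. *)
Record kcategory (k : fieldType) := KCategory {
  kobj :> Type;
  khom : kobj -> kobj -> lmodType k;
  kid : forall x, khom x x;
  kcomp : forall x y z, khom y z -> khom x y -> khom x z;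
  kcompA : forall x y z w (h : khom z w) (g : khom y z) (f : khom x y),
    kcomp h (kcomp g f) = kcomp (kcomp h g) f;
  kcomp1m : forall x y (f : khom x y), kcomp (kid y) f = f;
  kcompm1 : forall x y (f : khom x y), kcomp f (kid x) = f;
  kcomp_linearl : forall x y z (f : khom x y),
    linear (fun g : khom y z => kcomp g f);
  kcomp_linearr : forall x y z (g : khom y z),
    linear (fun f : khom x y => kcomp g f) }.
Arguments khom {k _} _ _.
Arguments kid {k _} _.

(* Covariant k-linear functors to k-vector spaces. *)
Record kmodule (k : fieldType) (C : kcategory k) := KModule {
  kmobj :> C -> lmodType k;
  kmap : forall x y : C, khom x y -> {linear kmobj x -> kmobj y};
  kmap_linear : forall (x y : C) (u : kmobj x),
    linear (fun f : khom x y => kmap f u);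
  kmap1 : forall (x : C) (u : kmobj x), kmap (kid x) u = u;
  kmapM : forall (x y z : C) (g : khom y z) (f : khom x y) (u : kmobj x),
    kmap (kcomp g f) u = kmap g (kmap f u) }.
Arguments kmap {k C} _ {x y} _.

Record kmodule_hom (k : fieldType) (C : kcategory k) (M N : kmodule C) :=
  KModuleHom {
    kmhom :> forall x : C, {linear M x -> N x};
    kmhom_natural : forall (x y : C) (f : khom x y) (u : M x),
      kmhom y (kmap M f u) = kmap N f (kmhom x u) }.

Lemma linear_ext (k : fieldType) (U V : lmodType k) (f g : {linear U -> V}) :
  f =1 g -> f = g.
Proof.
case: f => f [[af] [sf]]; case: g => g [[ag] [sg]] /= /funext E.
by subst g; rewrite (Prop_irrelevance af ag) (Prop_irrelevance sf sg).
Qed.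

Lemma kmodule_hom_ext (k : fieldType) (C : kcategory k) (M N : kmodule C)
    (f g : kmodule_hom M N) : (forall x, f x =1 g x) -> f = g.
Proof.
case: f => f fP; case: g => g gP /= E.
have {}E : f = g.
  by apply: functional_extensionality_dep => x; apply: linear_ext; apply: E.
by subst g; rewrite (Prop_irrelevance fP gP).
Qed.

Program Definition kmodule_category (k : fieldType) (C : kcategory k) :
    category :=
  @Category (kmodule C) (@kmodule_hom k C)
    (fun M => @KModuleHom k C M M (fun x => idfun) _)
    (fun M N P g f => @KModuleHom k C M P (fun x => g x \o f x) _) _ _ _.
Next Obligation.
by move=> k C M N P g f x y h u /=; rewrite !kmhom_natural.
Qed.
Next Obligation. by move=> *; apply: kmodule_hom_ext. Qed.
Next Obligation. by move=> *; apply: kmodule_hom_ext. Qed.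
Next Obligation. by move=> *; apply: kmodule_hom_ext. Qed.

Record nualgebra (k : fieldType) := NuAlgebra {
  nuspace :> lmodType k;
  numul : nuspace -> nuspace -> nuspace;
  numulA : forall a b c, numul a (numul b c) = numul (numul a b) c;
  numul_linearl : forall b, linear (fun a => numul a b);
  numul_linearr : forall a, linear (fun b => numul a b) }.
Arguments numul {k _} _ _.

Record lmodule (k : fieldType) (A : nualgebra k) := LModule {
  lmspace :> lmodType k;
  lmact : A -> lmspace -> lmspace;
  lmactM : forall a b u, lmact (numul a b) u = lmact a (lmact b u);
  lmact_linearl : forall u, linear (fun a => lmact a u);
  lmact_linearr : forall a, linear (fun u => lmact a u) }.
Arguments lmact {k A _} _ _.

(* AM = M, where AM is the set of finite sums of products [lmact a u]. *)
Definition unital (k : fieldType) (A : nualgebra k) (M : lmodule A) : Prop :=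
  forall u : M, exists n (a : 'I_n -> A) (v : 'I_n -> M),
    u = \sum_(i < n) lmact (a i) (v i).

Record umodule (k : fieldType) (A : nualgebra k) := UModule {
  umlmod :> lmodule A;
  um_unital : unital umlmod }.

Record lmodule_hom (k : fieldType) (A : nualgebra k) (M N : lmodule A) :=
  LModuleHom {
    lmhom :> {linear M -> N};
    lmhom_act : forall (a : A) (u : M), lmhom (lmact a u) = lmact a (lmhom u) }.

Lemma lmodule_hom_ext (k : fieldType) (A : nualgebra k) (M N : lmodule A)
    (f g : lmodule_hom M N) : f =1 g -> f = g.
Proof.
case: f => f fP; case: g => g gP /= /linear_ext E.
by subst g; rewrite (Prop_irrelevance fP gP).
Qed.

Program Definition umodule_category (k : fieldType) (A : nualgebra k) :
    category :=
  @Category (umodule A) (fun M N => lmodule_hom M N)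
    (fun M => @LModuleHom k A M M idfun _)
    (fun M N P g f => @LModuleHom k A M P (g \o f) _) _ _ _.
Next Obligation. by move=> k A M N P g f a u /=; rewrite !lmhom_act. Qed.
Next Obligation. by move=> *; apply: lmodule_hom_ext. Qed.
Next Obligation. by move=> *; apply: lmodule_hom_ext. Qed.
Next Obligation. by move=> *; apply: lmodule_hom_ext. Qed.

(* [f y x] is the entry in row y and column x: a morphism from x to y. *)
Record cmatrix (k : fieldType) (C : kcategory k) := CMatrix {
  entry :> forall y x : C, khom x y;
  entry_finite : finite_set [set p : C * C | entry p.1 p.2 != 0] }.

Section MatrixAlgebra.
Variables (k : fieldType) (C : kcategory k).
Implicit Types f g h : cmatrix C.

Lemma cmatrix_ext f g : (forall y x, f y x = g y x) -> f = g.
Proof.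
case: f => f fP; case: g => g gP /= E.
have {}E : f = g.
  apply: functional_extensionality_dep => y.
  by apply: functional_extensionality_dep => x.
by subst g; rewrite (Prop_irrelevance fP gP).
Qed.

HB.instance Definition _ := gen_eqMixin (cmatrix C).
HB.instance Definition _ := gen_choiceMixin (cmatrix C).

Program Definition cmatrix0 : cmatrix C := @CMatrix k C (fun y x => 0) _.
Next Obligation.
by rewrite (_ : [set _ | _] = set0)// -subset0 => p /=; rewrite eqxx.
Qed.

Program Definition cmatrix_opp f : cmatrix C :=
  @CMatrix k C (fun y x => - f y x) _.
Next Obligation.
move=> f; apply: sub_finite_set (entry_finite f) => p /=.
by rewrite oppr_eq0.
Qed.

Program Definition cmatrix_add f g : cmatrix C :=
  @CMatrix k C (fun y x => f y x + g y x) _.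
Next Obligation.
move=> f g.
apply: (@sub_finite_set _ _ ([set p : C * C | f p.1 p.2 != 0]
                             `|` [set p : C * C | g p.1 p.2 != 0])).
  move=> p /=; have [->|] := eqVneq (f p.1 p.2) 0; last by left.
  by rewrite add0r; right.
by rewrite finite_setU; split; apply: entry_finite.
Qed.

Program Definition cmatrix_scale (a : k) f : cmatrix C :=
  @CMatrix k C (fun y x => a *: f y x) _.
Next Obligation.
move=> a f; apply: sub_finite_set (entry_finite f) => p /=.
by apply: contraNN => /eqP->; rewrite scaler0.
Qed.

Fact cmatrix_addA : associative cmatrix_add.
Proof. by move=> f g h; apply: cmatrix_ext => y x /=; rewrite addrA. Qed.
Fact cmatrix_addC : commutative cmatrix_add.
Proof. by move=> f g; apply: cmatrix_ext => y x /=; rewrite addrC. Qed.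
Fact cmatrix_add0 : left_id cmatrix0 cmatrix_add.
Proof. by move=> f; apply: cmatrix_ext => y x /=; rewrite add0r. Qed.
Fact cmatrix_addN : left_inverse cmatrix0 cmatrix_opp cmatrix_add.
Proof. by move=> f; apply: cmatrix_ext => y x /=; rewrite addNr. Qed.
HB.instance Definition _ := GRing.isZmodule.Build (cmatrix C)
  cmatrix_addA cmatrix_addC cmatrix_add0 cmatrix_addN.

Fact cmatrix_scaleA (a b : k) f :
  cmatrix_scale a (cmatrix_scale b f) = cmatrix_scale (a * b) f.
Proof. by apply: cmatrix_ext => y x /=; rewrite scalerA. Qed.
Fact cmatrix_scale1 : left_id 1 cmatrix_scale.
Proof. by move=> f; apply: cmatrix_ext => y x /=; rewrite scale1r. Qed.
Fact cmatrix_scaleDr : right_distributive cmatrix_scale +%R.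
Proof. by move=> a f g; apply: cmatrix_ext => y x /=; rewrite scalerDr. Qed.
Fact cmatrix_scaleDl f : {morph cmatrix_scale^~ f : a b / a + b}.
Proof. by move=> a b; apply: cmatrix_ext => y x /=; rewrite scalerDl. Qed.
HB.instance Definition _ := GRing.Zmodule_isLmodule.Build k (cmatrix C)
  cmatrix_scaleA cmatrix_scale1 cmatrix_scaleDr cmatrix_scaleDl.

Lemma kcomp0m (x y z : C) (f : khom x y) : kcomp (0 : khom y z) f = 0.
Proof.
have := kcomp_linearl f (-1) (0 : khom y z) 0.
by rewrite scaler0 addr0 scaleN1r addNr.
Qed.

Lemma kcompm0 (x y z : C) (g : khom y z) : kcomp g (0 : khom x y) = 0.
Proof.
have := kcomp_linearr g (-1) (0 : khom x y) 0.
by rewrite scaler0 addr0 scaleN1r addNr.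
Qed.

(* [\sum_(_ \in _)] is 0 when the support is infinite; here it is always finite. *)
Definition cmatrix_mul_entry f g (y x : C) : khom x y :=
  \sum_(z \in [set: {classic C}]) kcomp (f y z) (g z x).

Fact cmatrix_mul_finite f g :
  finite_set [set p : C * C | cmatrix_mul_entry f g p.1 p.2 != 0].
Proof.
apply: (@sub_finite_set _ _ ((fst @` [set p : C * C | f p.1 p.2 != 0])
                            `*` (snd @` [set p : C * C | g p.1 p.2 != 0]))).
  move=> [y x] /=; apply: contra_neqP => /not_andP H.
  apply: fsbig1 => z _; case: H => H.
    have [->|n0] := eqVneq (f y z) 0; first by rewrite kcomp0m.
    by case: H; exists (y, z).
  have [->|n0] := eqVneq (g z x) 0; first by rewrite kcompm0.
  by case: H; exists (z, x).
by apply: finite_setX; apply: finite_image; apply: entry_finite.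
Qed.

Definition cmatrix_mul f g : cmatrix C := CMatrix (cmatrix_mul_finite f g).

Let cols f := snd @` [set p : C * C | f p.1 p.2 != 0].
Let rows f := fst @` [set p : C * C | f p.1 p.2 != 0].

Let coverP (A B : set C) : finite_set A -> finite_set B ->
  exists2 s : seq {classic C}, uniq s &
    (forall z : {classic C}, A z -> z \in s)
    /\ (forall z : {classic C}, B z -> z \in s).
Proof.
move=> fA fB; have : finite_set (A `|` B : set {classic C}).
  by rewrite finite_setU.
move=> /finite_seqP[s E]; exists (undup s); first exact: undup_uniq.
have sP (z : {classic C}) : (A `|` B) z -> z \in undup s.
  by rewrite E mem_undup.
by split=> z ?; apply: sP; [left|right].
Qed.

Let mulE f g (s : seq {classic C}) (y x : C) : uniq s ->
    (forall z : {classic C}, cols f z -> z \in s)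
    \/ (forall z : {classic C}, rows g z -> z \in s) ->
  cmatrix_mul f g y x = \sum_(z <- s) kcomp (f y z) (g z x).
Proof.
move=> us H; rewrite /= /cmatrix_mul_entry.
rewrite [RHS]fsbig_seq//; apply/esym/fsbig_widen => // z [_ /= zs].
have [->|fn0] := eqVneq (f y z) 0; first by rewrite kcomp0m.
have [->|gn0] := eqVneq (g z x) 0; first by rewrite kcompm0.
by case: zs; case: H => H; apply: H; [exists (y, z)|exists (z, x)].
Qed.

Let kcomp_suml (I : Type) (s : seq I) (x y z : C) (f : khom x y)
    (F : I -> khom y z) :
  kcomp (\sum_(i <- s) F i) f = \sum_(i <- s) kcomp (F i) f.
Proof.
elim/big_ind2: _ => [|a b c d <- <-|//]; first exact: kcomp0m.
by have := kcomp_linearl f 1 b d; rewrite !scale1r => <-.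
Qed.

Let kcomp_sumr (I : Type) (s : seq I) (x y z : C) (g : khom y z)
    (F : I -> khom x y) :
  kcomp g (\sum_(i <- s) F i) = \sum_(i <- s) kcomp g (F i).
Proof.
elim/big_ind2: _ => [|a b c d <- <-|//]; first exact: kcompm0.
by have := kcomp_linearr g 1 b d; rewrite !scale1r => <-.
Qed.

Let fin_cols f : finite_set (cols f).
Proof. exact/finite_image/entry_finite. Qed.

Let fin_rows f : finite_set (rows f).
Proof. exact/finite_image/entry_finite. Qed.

Fact cmatrix_mulA f g h :
  cmatrix_mul f (cmatrix_mul g h) = cmatrix_mul (cmatrix_mul f g) h.
Proof.
have [s us [sf sh]] := coverP (fin_cols f) (fin_rows h).
apply: cmatrix_ext => y x.
rewrite (@mulE f _ s)//; last by left.
rewrite (@mulE _ h s)//; last by right.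
transitivity (\sum_(z <- s) \sum_(w <- s)
    kcomp (f y z) (kcomp (g z w) (h w x))).
  by apply: eq_bigr => z _; rewrite (@mulE g h s) ?kcomp_sumr//; right.
transitivity (\sum_(w <- s) \sum_(z <- s)
    kcomp (kcomp (f y z) (g z w)) (h w x)); last first.
  by apply: eq_bigr => w _; rewrite (@mulE f g s) ?kcomp_suml//; left.
rewrite exchange_big; apply: eq_bigr => w _; apply: eq_bigr => z _.
exact: kcompA.
Qed.

Fact cmatrix_mul_linearl g : linear (fun f => cmatrix_mul f g).
Proof.
move=> a f f'; have [s us [sg _]] := coverP (fin_rows g) (fin_rows g).
apply: cmatrix_ext => y x; rewrite (@mulE _ g s)//; last by right.
transitivity (a *: cmatrix_mul f g y x + cmatrix_mul f' g y x); last by [].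
rewrite !(@mulE _ g s)//; try by right.
rewrite scaler_sumr -big_split; apply: eq_bigr => z _.
exact: kcomp_linearl.
Qed.

Fact cmatrix_mul_linearr f : linear (fun g => cmatrix_mul f g).
Proof.
move=> a g g'; have [s us [sf _]] := coverP (fin_cols f) (fin_cols f).
apply: cmatrix_ext => y x; rewrite (@mulE f _ s)//; last by left.
transitivity (a *: cmatrix_mul f g y x + cmatrix_mul f g' y x); last by [].
rewrite !(@mulE f _ s)//; try by left.
rewrite scaler_sumr -big_split; apply: eq_bigr => z _.
exact: kcomp_linearr.
Qed.

Definition category_algebra : nualgebra k :=
  NuAlgebra cmatrix_mulA cmatrix_mul_linearl cmatrix_mul_linearr.

End MatrixAlgebra.

(* Main.v *)
(* A module M goes to the direct sum of its values, on which a matrix acts by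
   matrix-vector multiplication.  Conversely, writing e_x for the matrix unit
   of the identity of x, a unital module N goes to the family of its corners
   e_x N, on which f : x -> y acts through its matrix unit.  The e_x are
   orthogonal idempotents and every matrix is a finite sum of its rows e_y a;
   hence a unital N is the direct sum of the e_x N. *)
Require Import Defs.
From HB Require Import structures.
From mathcomp Require Import all_boot all_order all_algebra.
From mathcomp Require Import boolp classical_sets functions cardinality fsbigop.

Set Implicit Arguments.
Unset Strict Implicit.
Unset Printing Implicit Defensive.

Import GRing.Theory.
Local Open Scope classical_set_scope.
Local Open Scope ring_scope.

(** Bundles a bare proof of linearity, so that [linear0] and [linear_sum] apply to maps such as
    evaluation at an index or an action with one argument fixed. *)
Definition linear_of (k : fieldType) (U V : lmodType k) (f : U -> V)
    (fL : linear f) : {linear U -> V} :=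
  HB.pack f (GRing.isLinear.Build k U V *:%R f fL).

(** * Finitely supported sums over an arbitrary index type *)

Section FiniteSums.
Variable T : Type.

(** [{classic T}] is [T] with classically decided equality, which membership in a sequence
    requires. *)
Lemma finite_cover (A : set T) : finite_set A ->
  exists2 s : seq {classic T}, uniq s & forall z : {classic T}, A z -> z \in s.
Proof.
move=> /(@finite_seqP {classic T})[s E]; exists (undup s).
  exact: undup_uniq.
by move=> z; rewrite E mem_undup.
Qed.

(** Bridge to big operators over sequences, where sums can be exchanged and split. Any
    duplicate-free [s] containing the support will do, so several sums can share one [s]. *)
Lemma fsumE (V : zmodType) (F : {classic T} -> V) (s : seq {classic T}) :
    uniq s -> (forall z, z \notin s -> F z = 0) ->
  \sum_(z \in [set: {classic T}]) F z = \sum_(z <- s) F z.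
Proof.
move=> us H; rewrite [RHS]fsbig_seq//; apply/esym/fsbig_widen => // z [_ /= zs].
by apply: H; apply/negP.
Qed.

Lemma fsum1 (V : zmodType) (F : {classic T} -> V) (x : T) :
    (forall z, z <> x -> F z = 0) ->
  \sum_(z \in [set: {classic T}]) F z = F x.
Proof.
move=> H; rewrite (@fsumE _ _ [:: (x : {classic T})])// ?big_seq1// => z.
by rewrite inE => /eqP; apply: H.
Qed.

(** The family concentrated at [x]. As [V] depends on the index, [v] reaches [V y] only by transport
    along a proof of [x = y]. *)
Definition dirac (V : T -> zmodType) (x : T) (v : V x) (y : T) : V y :=
  match pselect (x = y) with
  | left e => eq_rect x V v y e
  | right _ => 0
  end.

Lemma dirac_id (V : T -> zmodType) (x : T) (v : V x) : dirac v x = v.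
Proof.
rewrite /dirac; case: pselect => // e.
by rewrite (Prop_irrelevance e (erefl x)).
Qed.

Lemma dirac_neq (V : T -> zmodType) (x : T) (v : V x) (y : T) :
  x <> y -> dirac v y = 0.
Proof. by rewrite /dirac; case: pselect. Qed.

Lemma dirac_finite (V : T -> zmodType) (x : T) (v : V x) :
  finite_set [set y | dirac v y != 0].
Proof.
apply: (@sub_finite_set _ _ [set x]); last exact: finite_set1.
move=> y /= /eqP H; apply: contrapT => yx; apply: H.
by apply: dirac_neq => xy; apply: yx.
Qed.

End FiniteSums.

(** * The direct sum of a family of vector spaces *)

Record dsum (k : fieldType) (T : Type) (V : T -> lmodType k) := DSum {
  component :> forall x, V x;
  component_finite : finite_set [set x | component x != 0] }.

Section DirectSum.
Variables (k : fieldType) (T : Type) (V : T -> lmodType k).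
Implicit Types u v w : dsum V.

Lemma dsum_ext u v : (forall x, u x = v x) -> u = v.
Proof.
case: u => u uP; case: v => v vP /= E.
have {}E : u = v by apply: functional_extensionality_dep.
by subst v; rewrite (Prop_irrelevance uP vP).
Qed.

HB.instance Definition _ := gen_eqMixin (dsum V).
HB.instance Definition _ := gen_choiceMixin (dsum V).

Fact dsum0_finite : finite_set [set x | (0 : V x) != 0].
Proof.
by rewrite (_ : [set _ | _] = set0)// -subset0 => x /=; rewrite eqxx.
Qed.
Definition dsum0 : dsum V := DSum dsum0_finite.

Fact dsum_opp_finite u : finite_set [set x | - u x != 0].
Proof.
by apply: sub_finite_set (component_finite u) => x /=; rewrite oppr_eq0.
Qed.
Definition dsum_opp u : dsum V := DSum (dsum_opp_finite u).

Fact dsum_add_finite u v : finite_set [set x | u x + v x != 0].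
Proof.
apply: (@sub_finite_set _ _ ([set x | u x != 0] `|` [set x | v x != 0])).
  move=> x /=; have [->|] := eqVneq (u x) 0; last by left.
  by rewrite add0r; right.
by rewrite finite_setU; split; apply: component_finite.
Qed.
Definition dsum_add u v : dsum V := DSum (dsum_add_finite u v).

Fact dsum_scale_finite (a : k) u : finite_set [set x | a *: u x != 0].
Proof.
apply: sub_finite_set (component_finite u) => x /=.
by apply: contraNN => /eqP->; rewrite scaler0.
Qed.
Definition dsum_scale a u : dsum V := DSum (dsum_scale_finite a u).

Fact dsum_addA : associative dsum_add.
Proof. by move=> u v w; apply: dsum_ext => x /=; rewrite addrA. Qed.
Fact dsum_addC : commutative dsum_add.
Proof. by move=> u v; apply: dsum_ext => x /=; rewrite addrC. Qed.
Fact dsum_add0 : left_id dsum0 dsum_add.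
Proof. by move=> u; apply: dsum_ext => x /=; rewrite add0r. Qed.
Fact dsum_addN : left_inverse dsum0 dsum_opp dsum_add.
Proof. by move=> u; apply: dsum_ext => x /=; rewrite addNr. Qed.
HB.instance Definition _ := GRing.isZmodule.Build (dsum V)
  dsum_addA dsum_addC dsum_add0 dsum_addN.

Fact dsum_scaleA (a b : k) u :
  dsum_scale a (dsum_scale b u) = dsum_scale (a * b) u.
Proof. by apply: dsum_ext => x /=; rewrite scalerA. Qed.
Fact dsum_scale1 : left_id 1 dsum_scale.
Proof. by move=> u; apply: dsum_ext => x /=; rewrite scale1r. Qed.
Fact dsum_scaleDr : right_distributive dsum_scale +%R.
Proof. by move=> a u v; apply: dsum_ext => x /=; rewrite scalerDr. Qed.
Fact dsum_scaleDl u : {morph dsum_scale^~ u : a b / a + b}.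
Proof. by move=> a b; apply: dsum_ext => x /=; rewrite scalerDl. Qed.
HB.instance Definition _ := GRing.Zmodule_isLmodule.Build k (dsum V)
  dsum_scaleA dsum_scale1 dsum_scaleDr dsum_scaleDl.

Fact component_linear x : linear (fun u => u x).
Proof. by []. Qed.

Lemma dsum_sumE (I : Type) (s : seq I) (F : I -> dsum V) x :
  (\sum_(i <- s) F i) x = \sum_(i <- s) F i x.
Proof. exact: (linear_sum (linear_of (component_linear x))). Qed.

(** The inclusion of the summand at [x]. *)
Definition dsum1 (x : T) (m : V x) : dsum V := DSum (dirac_finite m).

Lemma dsum_cover u : exists2 s : seq {classic T}, uniq s &
  forall z : {classic T}, z \notin s -> u z = 0.
Proof.
have [s us sP] := finite_cover (component_finite u).
by exists s => // z; apply: contraNeq => /sP.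
Qed.

End DirectSum.

(** * Matrix units of the category algebra *)

Section MatrixUnits.
Variables (k : fieldType) (C : kcategory k).
Local Notation A := (category_algebra C).
Implicit Types a b : A.

(** Indexing [dirac] by the pair (row, column) handles both transports with a single equality. *)
Definition munit_entry (x y : C) (f : khom x y) (z w : C) : khom w z :=
  @dirac _ (fun p : C * C => khom p.2 p.1) (y, x) f (z, w).

Fact munit_finite (x y : C) (f : khom x y) :
  finite_set [set p : C * C | munit_entry f p.1 p.2 != 0].
Proof.
by apply: sub_finite_set (dirac_finite (V := fun p => khom p.2 p.1)
  (x := (y, x)) f) => -[].
Qed.

Definition munit (x y : C) (f : khom x y) : A := CMatrix (munit_finite f).

Lemma munitE (x y : C) (f : khom x y) : munit f y x = f.
Proof. exact: (@dirac_id _ (fun p : C * C => khom p.2 p.1) (y, x) f). Qed.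

Lemma munit_row0 (x y : C) (f : khom x y) (z w : C) :
  y <> z -> munit f z w = 0.
Proof. by move=> yz; apply: dirac_neq => -[]. Qed.

Lemma munit_col0 (x y : C) (f : khom x y) (z w : C) :
  x <> w -> munit f z w = 0.
Proof. by move=> xw; apply: dirac_neq => -[]. Qed.

Lemma munit_linear (x y : C) : linear (@munit x y).
Proof.
move=> c f g; apply: cmatrix_ext => z w.
transitivity (c *: munit f z w + munit g z w); last by [].
have [->|yz] := pselect (z = y); last first.
  by rewrite !munit_row0 ?scaler0 ?addr0// => /esym.
have [->|xw] := pselect (w = x); last first.
  by rewrite !munit_col0 ?scaler0 ?addr0// => /esym.
by rewrite !munitE.
Qed.

Lemma numulE a b (y x : C) : numul a b y x =
  \sum_(z \in [set: {classic C}]) kcomp (a y z) (b z x).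
Proof. by []. Qed.

Lemma mul_munit a (x y : C) (f : khom x y) z :
  numul a (munit f) z x = kcomp (a z y) f.
Proof.
rewrite numulE (fsum1 (x := y)) ?munitE// => w wy.
by rewrite munit_row0 ?kcompm0// => /esym.
Qed.

Lemma mul_munit0 a (x y : C) (f : khom x y) z w :
  x <> w -> numul a (munit f) z w = 0.
Proof.
move=> xw; rewrite numulE (fsum1 (x := y)); first by rewrite munit_col0 ?kcompm0.
by move=> v _; rewrite munit_col0 ?kcompm0.
Qed.

Lemma munit_mul (x y : C) (f : khom x y) b w :
  numul (munit f) b y w = kcomp f (b x w).
Proof.
rewrite numulE (fsum1 (x := x)) ?munitE// => z zx.
by rewrite munit_col0 ?kcomp0m// => /esym.
Qed.

Lemma munit_mul0 (x y : C) (f : khom x y) b z w :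
  y <> z -> numul (munit f) b z w = 0.
Proof.
move=> yz; rewrite numulE (fsum1 (x := x)); first by rewrite munit_row0 ?kcomp0m.
by move=> v _; rewrite munit_row0 ?kcomp0m.
Qed.

Lemma munitM (x y z : C) (g : khom y z) (f : khom x y) :
  numul (munit g) (munit f) = munit (kcomp g f).
Proof.
apply: cmatrix_ext => v w.
have [->|zv] := pselect (v = z); last first.
  by rewrite munit_mul0 ?munit_row0// => /esym.
have [->|xw] := pselect (w = x); last first.
  by rewrite mul_munit0 ?munit_col0// => /esym.
by rewrite mul_munit !munitE.
Qed.

(** Row [z] of the product is [g] times row [y] of [munit f], which is zero. For identities this is
    the orthogonality of the e_x. *)
Lemma munitM0 (x y z w : C) (g : khom y z) (f : khom x w) :
  y <> w -> numul (munit g) (munit f) = 0.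
Proof.
move=> yw; apply: cmatrix_ext => v t.
have [->|zv] := pselect (v = z); last first.
  by rewrite munit_mul0// => /esym.
by rewrite munit_mul munit_row0 ?kcompm0// => /esym.
Qed.

Definition unit_at (x : C) : A := munit (kid x).

Lemma entry_linear (y x : C) : linear (fun a : A => a y x).
Proof. by []. Qed.

Lemma cmatrix_sumE (I : Type) (s : seq I) (F : I -> A) (y x : C) :
  (\sum_(i <- s) F i) y x = \sum_(i <- s) F i y x.
Proof. exact: (linear_sum (linear_of (entry_linear y x))). Qed.

Lemma col_cover a : exists2 s : seq {classic C}, uniq s &
  forall x : {classic C}, x \notin s -> forall y, a y x = 0.
Proof.
have [s us sP] := finite_cover (finite_image snd (entry_finite a)).
exists s => // x xs y; apply: contraNeq xs => axy.
by apply: sP; exists (y, x).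
Qed.

(** Left multiplication by e_y keeps row [y] and kills the others. Thus the sum of the e_y over [s]
    is a left unit for [a], a substitute for the identity that the algebra may lack. *)
Lemma sum_rows a (s : seq {classic C}) : uniq s ->
    (forall y : {classic C}, y \notin s -> forall x, a y x = 0) ->
  a = \sum_(y <- s) numul (unit_at y) a.
Proof.
move=> us sP; apply: cmatrix_ext => y x; rewrite cmatrix_sumE.
rewrite -(@fsumE _ _ (fun z => numul (unit_at z) a y x))//; last first.
  move=> z zs; have [->|zy] := pselect (y = z); last first.
    by rewrite munit_mul0// => /esym.
  by rewrite munit_mul sP ?kcompm0.
rewrite (fsum1 (x := y)) ?munit_mul ?kcomp1m// => z zy.
by rewrite munit_mul0.
Qed.

Lemma row_munitE a y (s : seq {classic C}) : uniq s ->
    (forall x : {classic C}, x \notin s -> a y x = 0) ->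
  numul (unit_at y) a = \sum_(x <- s) munit (a y x).
Proof.
move=> us sP; apply: cmatrix_ext => z x; rewrite cmatrix_sumE.
have [->|zy] := pselect (z = y); last first.
  rewrite munit_mul0; last by move=> /esym.
  by rewrite big1// => w _; rewrite munit_row0// => /esym.
rewrite munit_mul kcomp1m.
rewrite -(@fsumE _ _ (fun w => munit (a y w) y x))//; last first.
  move=> w ws; have [->|wx] := pselect (x = w); last first.
    by rewrite munit_col0// => /esym.
  by rewrite munitE sP.
by rewrite (fsum1 (x := x)) ?munitE// => w wx; rewrite munit_col0.
Qed.

End MatrixUnits.

(** * From modules over the category to unital modules: the direct sum of values *)

Section TotalModule.
Variables (k : fieldType) (C : kcategory k).
Local Notation A := (category_algebra C).

Lemma kmap0 (M : kmodule C) (x y : C) (u : M x) :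
  kmap M (0 : khom x y) u = 0.
Proof. exact: (linear0 (linear_of (@kmap_linear _ _ M x y u))). Qed.

Lemma kmap_suml (M : kmodule C) (x y : C) (u : M x) (I : Type) (s : seq I)
    (F : I -> khom x y) :
  kmap M (\sum_(i <- s) F i) u = \sum_(i <- s) kmap M (F i) u.
Proof. exact: (linear_sum (linear_of (@kmap_linear _ _ M x y u))). Qed.

Section Object.
Variable M : kmodule C.
Implicit Types (a b : A) (u : dsum M).

Definition total_act_component a u (y : C) : M y :=
  \sum_(x \in [set: {classic C}]) kmap M (a y x) (u x).

Fact total_act_finite a u : finite_set [set y | total_act_component a u y != 0].
Proof.
apply: sub_finite_set (finite_image fst (entry_finite a)) => y /= n0.
apply: contrapT => H; move/eqP: n0; apply; apply: fsbig1 => x _.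
have [->|n0] := eqVneq (a y x) 0; first by rewrite kmap0.
by case: H; exists (y, x).
Qed.

Definition total_act a u : dsum M := DSum (total_act_finite a u).

(** Covering the columns of [a] or the support of [u] suffices. A cover that depends on one factor
    only stays valid while the other varies, as the linearity proofs require. *)
Lemma total_actE a u (s : seq {classic C}) y : uniq s ->
    (forall x : {classic C}, x \notin s -> a y x = 0)
    \/ (forall x : {classic C}, x \notin s -> u x = 0) ->
  total_act a u y = \sum_(x <- s) kmap M (a y x) (u x).
Proof.
move=> us H; apply: fsumE => // x xs.
by case: H => ->//; [rewrite kmap0|rewrite linear0].
Qed.

Lemma total_act_munit (x y : C) (f : khom x y) u :
  total_act (munit f) u y = kmap M f (u x).
Proof.
rewrite /= /total_act_component (fsum1 (x := x)) ?munitE// => z zx.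
by rewrite munit_col0 ?kmap0// => /esym.
Qed.

Lemma total_act_munit0 (x y : C) (f : khom x y) u z :
  y <> z -> total_act (munit f) u z = 0.
Proof.
move=> yz; apply: fsbig1 => w _.
by rewrite munit_row0 ?kmap0.
Qed.

Fact total_actM a b u : total_act (numul a b) u = total_act a (total_act b u).
Proof.
have [s us sP] := dsum_cover u; have [t ut tP] := col_cover a.
apply: dsum_ext => y.
rewrite (@total_actE _ _ s)//; last by right.
rewrite (@total_actE _ _ t)//; last by left=> x /tP.
(* [s] covers the support of [u] and [t] the columns of [a], so both sides become double sums over
   [s] and [t], for every [b]. *)
transitivity (\sum_(x <- s) \sum_(z <- t)
    kmap M (a y z) (kmap M (b z x) (u x))).
  apply: eq_bigr => x _; rewrite numulE (@fsumE _ _ _ t)//.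
    by rewrite kmap_suml; apply: eq_bigr => z _; rewrite kmapM.
  by move=> z /tP ->; rewrite kcomp0m.
rewrite exchange_big; apply: eq_bigr => z _.
by rewrite (@total_actE b u s) ?linear_sum//; right.
Qed.

Fact total_act_linearl u : linear (fun a => total_act a u).
Proof.
move=> c a b; have [s us sP] := dsum_cover u; apply: dsum_ext => y.
transitivity (c *: total_act a u y + total_act b u y); last by [].
rewrite !(@total_actE _ _ s)//; try by right.
rewrite scaler_sumr -big_split; apply: eq_bigr => x _.
exact: kmap_linear.
Qed.

Fact total_act_linearr a : linear (fun u => total_act a u).
Proof.
move=> c u v; have [s us sP] := col_cover a; apply: dsum_ext => y.
transitivity (c *: total_act a u y + total_act a v y); last by [].
rewrite !(@total_actE _ _ s)//; try by left=> x /sP.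
rewrite scaler_sumr -big_split; apply: eq_bigr => x _.
exact: linearP.
Qed.

Definition total_lmodule : lmodule A :=
  LModule total_actM total_act_linearl total_act_linearr.

Fact total_unital : unital total_lmodule.
Proof.
move=> u; have [s us sP] := dsum_cover u.
(* With [s] covering the support of [u], the decomposition is [u] as the sum of the e_x [u] for [x]
   in [s]. *)
exists (size s), (fun i => unit_at (tnth (in_tuple s) i)), (fun=> u).
rewrite -(big_tnth _ _ s xpredT (fun x => total_act (unit_at x) u)).
apply: dsum_ext => y; rewrite dsum_sumE.
rewrite -(@fsumE _ _ (fun z => total_act (unit_at z) u y))//; last first.
  move=> z zs; have [->|zy] := pselect (y = z); last first.
    by rewrite total_act_munit0// => /esym.
  by rewrite total_act_munit sP ?linear0.
rewrite (fsum1 (x := y)) ?total_act_munit ?kmap1// => z zy.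
by rewrite total_act_munit0.
Qed.

Definition total : umodule A := UModule total_unital.

End Object.

Section Morphism.
Variables (M N : kmodule C) (h : kmodule_hom M N).

Fact total_map_finite (u : dsum M) : finite_set [set x | h x (u x) != 0].
Proof.
apply: sub_finite_set (component_finite u) => x /=.
by apply: contraNN => /eqP->; rewrite linear0.
Qed.

Definition total_map (u : dsum M) : dsum N := DSum (total_map_finite u).

Fact total_map_linear : linear total_map.
Proof. by move=> c u v; apply: dsum_ext => x /=; rewrite linearP. Qed.

Fact total_map_act a u : linear_of total_map_linear (total_act a u) =
  total_act a (linear_of total_map_linear u).
Proof.
have [s us sP] := dsum_cover u; apply: dsum_ext => y.
rewrite (@total_actE _ _ _ s)//; last by right=> x /sP /= ->; rewrite linear0.
transitivity (h y (total_act a u y)); first by [].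
rewrite (@total_actE _ _ _ s)//; last by right.
by rewrite linear_sum; apply: eq_bigr => x _; rewrite kmhom_natural.
Qed.

Definition total_hom : lmodule_hom (total M) (total N) :=
  @LModuleHom _ _ (total M) (total N) (linear_of total_map_linear)
    total_map_act.

End Morphism.

Fact total_hom1 (M : kmodule C) :
  total_hom (idm (M : kmodule_category C)) =
  idm (total M : umodule_category A).
Proof. by apply: lmodule_hom_ext => u; apply: dsum_ext. Qed.

Fact total_homM (M N P : kmodule_category C) (g : mor N P) (h : mor M N) :
  total_hom (mcomp g h) =
  mcomp (total_hom g : mor (total N : umodule_category A) (total P))
    (total_hom h).
Proof. by apply: lmodule_hom_ext => u; apply: dsum_ext. Qed.

Definition total_functor :
    functor (kmodule_category C) (umodule_category A) :=
  @Functor (kmodule_category C) (umodule_category A)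
    total total_hom total_hom1 total_homM.

End TotalModule.

(** * From unital modules back to modules over the category: the corners *)

Section LModuleTheory.
Variables (k : fieldType) (A : nualgebra k) (N : lmodule A).

Lemma lmact_suml (u : N) (I : Type) (s : seq I) (F : I -> A) :
  lmact (\sum_(i <- s) F i) u = \sum_(i <- s) lmact (F i) u.
Proof. exact: (linear_sum (linear_of (lmact_linearl u))). Qed.

Lemma lmact_sumr (a : A) (I : Type) (s : seq I) (F : I -> N) :
  lmact a (\sum_(i <- s) F i) = \sum_(i <- s) lmact a (F i).
Proof. exact: (linear_sum (linear_of (lmact_linearr a))). Qed.

Lemma lmact0l (u : N) : lmact (0 : A) u = 0.
Proof. exact: (linear0 (linear_of (lmact_linearl u))). Qed.

Lemma lmact0r (a : A) : lmact a (0 : N) = 0.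
Proof. exact: (linear0 (linear_of (lmact_linearr a))). Qed.

End LModuleTheory.

(** The corner e_x N appears as the fixed points of e_x, which agree with its image because e_x is
    idempotent. This makes membership an equation, linear in [u]. *)
Definition in_corner (k : fieldType) (C : kcategory k)
    (N : lmodule (category_algebra C)) (x : C) : {pred N} :=
  fun u => lmact (unit_at x) u == u.

Fact in_corner_submod (k : fieldType) (C : kcategory k)
    (N : lmodule (category_algebra C)) (x : C) :
  GRing.submod_closed (in_corner (N := N) x).
Proof.
split; first by rewrite unfold_in /in_corner lmact0r.
move=> c u v /eqP uE /eqP vE; apply/eqP.
by rewrite lmact_linearr uE vE.
Qed.

HB.instance Definition _ (k : fieldType) (C : kcategory k)
    (N : lmodule (category_algebra C)) (x : C) :=
  GRing.isSubmodClosed.Build k N (in_corner (N := N) x)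
    (in_corner_submod N x).

Record corner (k : fieldType) (C : kcategory k)
    (N : lmodule (category_algebra C)) (x : C) := Corner {
  corner_val :> N;
  cornerP : corner_val \in in_corner (N := N) x }.

HB.instance Definition _ (k : fieldType) (C : kcategory k)
    (N : lmodule (category_algebra C)) (x : C) :=
  [isSub for @corner_val k C N x].
HB.instance Definition _ (k : fieldType) (C : kcategory k)
    (N : lmodule (category_algebra C)) (x : C) :=
  [Choice of corner N x by <:].
HB.instance Definition _ (k : fieldType) (C : kcategory k)
    (N : lmodule (category_algebra C)) (x : C) :=
  [SubChoice_isSubLmodule of corner N x by <:].

Section CornerModule.
Variables (k : fieldType) (C : kcategory k).
Local Notation A := (category_algebra C).

Section Object.
Variable N : lmodule A.

Lemma corner_act (x : C) (u : corner N x) :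
  lmact (unit_at x) (u : N) = u.
Proof. exact/eqP/cornerP. Qed.

(** Because e_y times [munit f] is [munit f]. Here [u] ranges over all of [N], so that the case of
    an identity also yields the projection [to_corner]. *)
Fact corner_map_proof (x y : C) (f : khom x y) (u : N) :
  lmact (munit f) u \in in_corner (N := N) y.
Proof. by apply/eqP; rewrite -lmactM munitM kcomp1m. Qed.

Definition corner_map (x y : C) (f : khom x y) (u : corner N x) :
    corner N y := Corner (corner_map_proof f u).

Fact corner_map_linear (x y : C) (f : khom x y) : linear (corner_map f).
Proof. by move=> c u v; apply: val_inj; rewrite /= lmact_linearr. Qed.

Fact corner_map_linearl (x y : C) (u : corner N x) :
  linear (fun f : khom x y => linear_of (corner_map_linear f) u).
Proof.
by move=> c f g; apply: val_inj; rewrite /= munit_linear lmact_linearl.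
Qed.

Fact corner_map1 (x : C) (u : corner N x) :
  linear_of (corner_map_linear (kid x)) u = u.
Proof. by apply: val_inj; apply: corner_act. Qed.

Fact corner_mapM (x y z : C) (g : khom y z) (f : khom x y) (u : corner N x) :
  linear_of (corner_map_linear (kcomp g f)) u =
  linear_of (corner_map_linear g) (linear_of (corner_map_linear f) u).
Proof. by apply: val_inj; rewrite /= -munitM lmactM. Qed.

Definition corners : kmodule C :=
  @KModule k C (fun x => corner N x) _
    corner_map_linearl corner_map1 corner_mapM.

End Object.

Section Morphism.
Variables (M N : lmodule A) (h : lmodule_hom M N).

Fact corners_hom_proof x (u : corner M x) :
  h (u : M) \in in_corner (N := N) x.
Proof. by apply/eqP; rewrite -lmhom_act corner_act. Qed.

Definition corners_hom_at x (u : corner M x) : corner N x :=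
  Corner (corners_hom_proof u).

Fact corners_hom_linear x : linear (@corners_hom_at x).
Proof. by move=> c u v; apply: val_inj; rewrite /= linearP. Qed.

Fact corners_hom_natural (x y : C) (f : khom x y) (u : corners M x) :
  linear_of (@corners_hom_linear y) (kmap (corners M) f u) =
  kmap (corners N) f (linear_of (@corners_hom_linear x) u).
Proof. by apply: val_inj; rewrite /= lmhom_act. Qed.

Definition corners_hom : kmodule_hom (corners M) (corners N) :=
  @KModuleHom k C (corners M) (corners N) _ corners_hom_natural.

End Morphism.

Fact corners_hom1 (N : umodule A) :
  corners_hom (idm (N : umodule_category A)) =
  idm (corners N : kmodule_category C).
Proof. by apply: kmodule_hom_ext => x u; apply: val_inj. Qed.

Fact corners_homM (M N P : umodule_category A) (g : mor N P) (h : mor M N) :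
  corners_hom (mcomp g h) =
  mcomp (corners_hom g : mor (corners N : kmodule_category C) (corners P))
    (corners_hom h).
Proof. by apply: kmodule_hom_ext => x u; apply: val_inj. Qed.

Definition corners_functor :
    functor (umodule_category A) (kmodule_category C) :=
  @Functor (umodule_category A) (kmodule_category C)
    (fun N => corners N) (fun M N h => corners_hom h)
    corners_hom1 corners_homM.

End CornerModule.

(** * Inverting natural transformations and bijective morphisms *)

Section Isomorphisms.

(** The inverses of the components, picked by choice, are again natural: conjugate the naturality
    square of [t]. *)
Lemma nat_isomorphic_sym (A B : category) (F G : functor A B) :
  nat_isomorphic F G -> nat_isomorphic G F.
Proof.
move=> [t [tN tI]].
have [s sP] := all_tag (fun a => cid (tI a)).
exists s; split; last first.
  by move=> a; exists (t a); case: (sP a).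
move=> a b f.
have -> : fmor F f = mcomp (s b) (mcomp (fmor G f) (t a)).
  by rewrite -tN Defs.compA (proj1 (sP b)) comp1m.
by rewrite -!Defs.compA (proj2 (sP a)) compm1.
Qed.

Lemma bij_linear_inverse (k : fieldType) (U V : lmodType k)
    (f : {linear U -> V}) :
  bijective f -> exists g : {linear V -> U}, cancel f g /\ cancel g f.
Proof.
by case=> g fK gK; exists (linear_of (can2_linear fK gK)).
Qed.

Lemma bij_kmodule_hom_iso (k : fieldType) (C : kcategory k)
    (M N : kmodule_category C) (h : mor M N) :
  (forall x : C, bijective (kmhom h x)) -> is_iso h.
Proof.
move=> bij.
have [g gP] := all_tag (fun x => cid (bij_linear_inverse (bij x))).
have gN (x y : C) (f : khom x y) u : g y (kmap N f u) = kmap M f (g x u).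
  have [[gK hK] [gK' hK']] := (gP x, gP y).
  (* After applying the injective map [h y], naturality of the inverses becomes naturality of
     [h]. *)
  by apply: (can_inj gK'); rewrite hK' kmhom_natural hK.
exists (KModuleHom gN).
by split; apply: kmodule_hom_ext => x u /=; case: (gP x).
Qed.

Lemma bij_lmodule_hom_iso (k : fieldType) (A : nualgebra k)
    (M N : umodule_category A) (h : mor M N) :
  bijective (lmhom h) -> is_iso h.
Proof.
move=> /bij_linear_inverse[g [gK hK]].
have gA (a : A) u : g (lmact a u) = lmact a (g u).
  by apply: (can_inj gK); rewrite hK lmhom_act hK.
exists (LModuleHom gA).
by split; apply: lmodule_hom_ext => u /=.
Qed.

Variables (k : fieldType) (C : kcategory k).
Local Notation A := (category_algebra C).

(** * The corners of a direct sum are its summands *)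

Section CornersTotal.
Variable M : kmodule C.

Definition corner_component (x : C) (u : corners (total M) x) : M x :=
  (val u : dsum M) x.

Fact corner_component_linear x : linear (@corner_component x).
Proof. by []. Qed.

Fact corner_component_natural (x y : C) (f : khom x y)
    (u : corners (total M) x) :
  linear_of (@corner_component_linear y) (kmap (corners (total M)) f u) =
  kmap M f (linear_of (@corner_component_linear x) u).
Proof. exact: total_act_munit. Qed.

Definition corners_total : kmodule_hom (corners (total M)) M :=
  @KModuleHom k C (corners (total M)) M _ corner_component_natural.

Fact corner_of_proof (x : C) (m : M x) :
  (dsum1 m : total M) \in in_corner (N := total M) x.
Proof.
apply/eqP; apply: dsum_ext => y.
have [->|xy] := pselect (y = x); first by rewrite total_act_munit kmap1.
by rewrite total_act_munit0 /= ?dirac_neq// => /esym.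
Qed.

Lemma corners_total_bij x : bijective (corners_total x).
Proof.
exists (fun m : M x => Corner (corner_of_proof m)); last first.
  by move=> m; apply: dirac_id.
move=> u; apply: val_inj; apply: dsum_ext => y.
have [->|xy] := pselect (y = x); first exact: dirac_id.
rewrite /= dirac_neq; last by move=> /esym.
(* [u] equals e_x [u], whose components away from [x] vanish. *)
by rewrite -(corner_act u) total_act_munit0// => /esym.
Qed.

End CornersTotal.

(** * A unital module is the direct sum of its corners *)

Section TotalCorners.
Variable N : umodule A.

(** Unitality enters here: [u] is a finite sum of products [a i] acting on [v i], and [s] collects
    the finitely many nonzero rows of all the [a i]. For [x] outside [s], e_x kills every [a i]; the
    sum of the e_x over [s] fixes every [a i]. *)
Lemma unital_cover (u : N) : exists2 s : seq {classic C}, uniq s &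
  (forall x : {classic C}, x \notin s -> lmact (unit_at x) u = 0)
  /\ u = \sum_(x <- s) lmact (unit_at x) u.
Proof.
have [n [a [v uE]]] := um_unital u.
have /finite_cover[s us sP] : finite_set (\bigcup_(i in [set: 'I_n])
    (fst @` [set p : C * C | (a i : A) p.1 p.2 != 0])).
  by apply: bigcup_finite => // i _; exact/finite_image/entry_finite.
have row0 i (y : {classic C}) : y \notin s -> forall x, a i y x = 0.
  move=> ys x; apply: contraNeq ys => n0; apply: sP; exists i => //.
  by exists (y, x).
exists s => //; split.
  move=> x xs; rewrite uE lmact_sumr big1// => i _; rewrite -lmactM.
  rewrite (_ : numul _ _ = 0) ?lmact0l//; apply: cmatrix_ext => y z.
  have [->|xy] := pselect (y = x); last by rewrite munit_mul0// => /esym.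
  by rewrite munit_mul row0 ?kcompm0.
rewrite [LHS]uE.
(* Only the [u] under each e_x is expanded; after the exchange of sums, [sum_rows] settles each [i]
   separately. *)
under [RHS]eq_bigr do rewrite [in X in lmact _ X]uE lmact_sumr.
rewrite exchange_big; apply: eq_bigr => i _.
rewrite [a i in LHS](sum_rows us (row0 i)) lmact_suml.
by apply: eq_bigr => x _; rewrite lmactM.
Qed.

Definition to_corner (u : N) (x : C) : corners N x :=
  Corner (corner_map_proof (kid x) u).

Fact to_corner_finite (u : N) : finite_set [set x | to_corner u x != 0].
Proof.
have [s us [sP _]] := unital_cover u.
apply: (@sub_finite_set _ _ [set` s]); last exact: finite_seq.
move=> x /=; apply: contraNT => /sP u0.
by apply/eqP; apply: val_inj.
Qed.

Definition decompose (u : N) : total (corners N) := DSum (to_corner_finite u).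

Fact decompose_linear : linear decompose.
Proof.
move=> c u v; apply: dsum_ext => x; apply: val_inj.
by rewrite /= lmact_linearr.
Qed.

Fact decompose_act (a : A) (u : N) : linear_of decompose_linear (lmact a u) =
  lmact a (linear_of decompose_linear u).
Proof.
have [s us sP] := col_cover a; apply: dsum_ext => y; apply: val_inj.
rewrite (@total_actE _ _ _ _ _ s)//; last by left=> x /sP.
(* At [y] the left side is e_y [a] acting on [u]. Row [y] of [a] splits into matrix units, and each
   absorbs the e_x of its column, which matches the right side. *)
rewrite linear_sum /= -lmactM (@row_munitE _ _ a y s)//; last first.
  by move=> x /sP.
rewrite lmact_suml; apply: eq_bigr => x _.
by rewrite -lmactM munitM kcompm1.
Qed.

Definition decompose_hom : lmodule_hom N (total (corners N)) :=
  @LModuleHom _ _ N (total (corners N)) _ decompose_act.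

(** If every e_x [u] vanishes, so does [u], being a sum of some of them. *)
Lemma decompose_inj : injective decompose_hom.
Proof.
apply: raddf_inj => u u0; have [s us [_ ->]] := unital_cover u.
apply: big1 => x _.
by have /(congr1 (fun w : dsum (corners N) => val (w x))) := u0.
Qed.

Lemma decompose_surj (w : total (corners N)) : exists u, decompose_hom u = w.
Proof.
have [s us sP] := dsum_cover (w : dsum (corners N)).
(* The preimage is the sum in [N] of the components of [w]; by orthogonality e_y retains only the
   one at [y]. *)
exists (\sum_(x <- s) val ((w : dsum (corners N)) x)).
apply: dsum_ext => y; apply: val_inj; rewrite /= lmact_sumr.
have H z : z <> y ->
    lmact (unit_at y) (val ((w : dsum (corners N)) z)) = 0 :> N.
  move=> zy; rewrite -[val _]corner_act -lmactM munitM0 ?lmact0l//.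
  by move=> /esym.
rewrite -(@fsumE _ _ (fun x => lmact (unit_at y)
  (val ((w : dsum (corners N)) x)) : N))//; last first.
  by move=> z /sP ->; exact: lmact0r.
by rewrite (fsum1 H); apply: corner_act.
Qed.

Lemma decompose_bij : bijective decompose_hom.
Proof.
have [g gK] := choice decompose_surj.
by exists g => // u; apply: decompose_inj; rewrite gK.
Qed.

End TotalCorners.

End Isomorphisms.

Theorem theorem74 (k : fieldType) (C : kcategory k) :
  equivalent_categories (kmodule_category C)
    (umodule_category (category_algebra C)).
Proof.
exists (total_functor C), (corners_functor C); split.
  exists (@corners_total k C); split.
    by move=> M N h; apply: kmodule_hom_ext.
  by move=> M; apply: bij_kmodule_hom_iso; apply: corners_total_bij.
(* [decompose_hom] runs from the identity to the composite, opposite to the direction in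
   [equivalent_categories]. *)
apply: nat_isomorphic_sym; exists (@decompose_hom k C); split.
  move=> M N h; apply: lmodule_hom_ext => u; apply: dsum_ext => x.
  by apply: val_inj; rewrite /= lmhom_act.
by move=> N; apply: bij_lmodule_hom_iso; apply: decompose_bij.
Qed.
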